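(* Let $(X,\|\cdot\|)$ be a complex Banach space, let $p\in\mathcal{P}([0,1])$ and let $f:[0,\infty)\to X$ be asymptotically $S^{p(x)}$-almost periodic. Then $f$ is asymptotically $S^{p(x)}$-almost automorphic.
   Context: Variable exponent spaces. $\mathcal{P}([0,1])$ is the set of all Lebesgue measurable functions $p:[0,1]\to[1,\infty]$. For $p\in\mathcal{P}([0,1])$ and $t\ge 0$ put $\varphi_{p(x)}(t)=t^{p(x)}$ if $p(x)<\infty$; if $p(x)=\infty$, put $\varphi_{p(x)}(t)=0$ for $0\le t\le 1$ and $\varphi_{p(x)}(t)=\infty$ for $t>1$. For measurable $u:[0,1]\to X$ let $\rho(u)=\int_0^1\varphi_{p(x)}(\|u(x)\|)\,dx$. The space $L^{p(x)}([0,1]:X)$ consists of all measurable $u:[0,1]\to X$ with $\rho(\lambda u)<\infty$ for some $\lambda>0$ (functions equal a.e. identified), with the Luxemburg norm $\|u\|_{L^{p(x)}([0,1]:X)}=\inf\{\lambda>0:\rho(u/\lambda)\le 1\}$; it is a Banach space. Stepanov $p(x)$-boundedness. Let $I=\mathbb{R}$ or $I=[0,\infty)$. $L_S^{p(x)}(I:X)$ is the space of measurable $f:I\to X$ such that $f(\cdot+t)\in L^{p(x)}([0,1]:X)$ for all $t\in I$ and $\|f\|_{S^{p(x)}}:=\sup_{t\in I}\|f(\cdot+t)\|_{L^{p(x)}([0,1]:X)}<\infty$. For $f\in L_S^{p(x)}(I:X)$ let $\hat f:I\to L^{p(x)}([0,1]:X)$, $\hat f(t):=f(t+\cdot)$.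 For a Banach space $Z$, $C_0([0,\infty):Z)$ denotes the continuous functions $[0,\infty)\to Z$ tending to $0$ at $+\infty$. A continuous function $[0,\infty)\to Z$ is asymptotically almost periodic iff it is the sum of (the restriction to $[0,\infty)$ of) a Bohr almost periodic function $\mathbb{R}\to Z$ and an element of $C_0([0,\infty):Z)$. A function $f\in L_S^{p(x)}([0,\infty):X)$ is asymptotically $S^{p(x)}$-almost periodic iff $\hat f:[0,\infty)\to L^{p(x)}([0,1]:X)$ is asymptotically almost periodic. A function $g\in L_S^{p(x)}(\mathbb{R}:X)$ is $S^{p(x)}$-almost automorphic iff for every real sequence $(a_n)$ there exist a subsequence $(a_{n_k})$ and a function $h\in L_S^{p(x)}(\mathbb{R}:X)$ such that, for each $t\in\mathbb{R}$, $\lim_{k\to\infty}\|g(a_{n_k}+\cdot+t)-h(\cdot+t)\|_{L^{p(x)}([0,1]:X)}=0$ and $\lim_{k\to\infty}\|h(\cdot-a_{n_k}+t)-g(\cdot+t)\|_{L^{p(x)}([0,1]:X)}=0$. A function $f\in L_S^{p(x)}([0,\infty):X)$ is asymptotically $S^{p(x)}$-almost automorphic iff there exist an $S^{p(x)}$-almost automorphic function $g\in L_S^{p(x)}(\mathbb{R}:X)$ and a function $q\in L_S^{p(x)}([0,\infty):X)$ such that $f(t)=g(t)+q(t)$ for $t\ge 0$ and $\hat q\in C_0([0,\infty):L^{p(x)}([0,1]:X))$. *)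

(* Defs.v *)
From HB Require Import structures.
From mathcomp Require Import all_boot all_order all_algebra.
From mathcomp Require Import complex.
From mathcomp Require Import all_classical all_reals all_analysis.
From mathcomp Require Import measurable_realfun.

Set Implicit Arguments.
Unset Strict Implicit.
Unset Printing Implicit Defensive.

Import Order.TTheory GRing.Theory Num.Theory.
Import numFieldNormedType.Exports.

Local Open Scope classical_set_scope.
Local Open Scope ring_scope.
Local Open Scope complex_scope.

(* The real line with the sigma-algebra of Lebesgue (not merely Borel)
   measurable sets, i.e. the domain of [completed_lebesgue_measure] (see
   [completed_caratheodory_measurable]). It is convertible to [R]. *)
Definition lebesgueR (R : realType) :=
  caratheodory_type (wlength (R := R) idfun)^*%mu.

HB.instance Definition _ (R : realType) := Measurable.on (lebesgueR R).

Definition leb (R : realType) : {measure set (lebesgueR R) -> \bar R} :=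
  @completed_lebesgue_measure R.

Definition unit_interval (R : realType) : set (lebesgueR R) :=
  [set` `[0 : R, 1]].

Definition half_line (R : realType) : set R := [set` `[0, +oo[].

(* P([0,1]). Exponents are total functions on R, of which only the values on
   [0,1] matter. *)
Definition variable_exponent (R : realType) (p : R -> \bar R) : Prop :=
  measurable_fun (@unit_interval R) (p : lebesgueR R -> \bar R) /\
  (forall x, unit_interval x -> (1 <= p x)%E).

(* The case p(x) = -oo is junk: it does not occur for exponents in P([0,1]). *)
Definition varphi (R : realType) (px : \bar R) (t : R) : \bar R :=
  match px with
  | r%:E => (t `^ r)%:E
  | +oo%E => if t <= 1 then 0%E else +oo%E
  | -oo%E => 0%E
  end.

(* Throughout, a function I -> X with I a subset of R is represented by a
   total function R -> X of which only the values on I are used, and an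
   element of L^{p(x)}([0,1]:X) by a representative function; equality in
   L^{p(x)}([0,1]:X) is [ae_eq01] below. *)
Section VariableExponent.
Variables (R : realType) (X : completeNormedModType R[i]).

(* The norm of X takes its values in R[i]; they are nonnegative reals. *)
Definition rnorm (v : X) : R := complex.Re `|v|.

(* Measurability of vector-valued functions is strong (Bochner) measurability:
   a.e. pointwise limit of measurable functions with finitely many values.
   X is not assumed to be separable. *)
Definition strongly_measurable (D : set R) (u : R -> X) : Prop :=
  exists s : nat -> R -> X,
    (forall n, finite_set (s n @` D) /\
       forall v, measurable ((D `&` s n @^-1` [set v]) : set (lebesgueR R))) /\
    {ae leb R, forall x : lebesgueR R,
       D x -> s n x @[n --> \oo] --> (u x : X)}.

Definition ae_eq01 (u v : R -> X) : Prop :=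
  {ae leb R, forall x : lebesgueR R, unit_interval x -> u x = v x}.

Variable p : R -> \bar R.

Definition rho (u : R -> X) : \bar R :=
  (\int[leb R]_(x in @unit_interval R) varphi (p x) (rnorm (u x)))%E.

Definition Lp (u : R -> X) : Prop :=
  strongly_measurable (@unit_interval R) u /\
  exists lambda : R, 0 < lambda /\ (rho (fun x => lambda%:C *: u x) < +oo)%E.

(* Luxemburg norm, with value +oo when no lambda is admissible. *)
Definition Lp_norm (u : R -> X) : \bar R :=
  ereal_inf [set lambda%:E | lambda in
    [set lambda : R | 0 < lambda /\
                      (rho (fun x => lambda^-1%:C *: u x) <= 1)%E]].

Definition hat (f : R -> X) : R -> (R -> X) := fun t x => f (t + x).

Definition LS (I : set R) (f : R -> X) : Prop :=
  strongly_measurable I f /\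
  (forall t, I t -> Lp (hat f t)) /\
  (ereal_sup [set Lp_norm (hat f t) | t in I] < +oo)%E.

(* Continuous functions I -> L^{p(x)}([0,1]:X). *)
Definition Lp_continuous (I : set R) (F : R -> (R -> X)) : Prop :=
  (forall t, I t -> Lp (F t)) /\
  (forall t, I t -> Lp_norm (F s - F t) @[s --> within I (nbhs t)] --> 0%E).

(* C_0([0,oo) : L^{p(x)}([0,1]:X)) *)
Definition Lp_C0 (Q : R -> (R -> X)) : Prop :=
  Lp_continuous (@half_line R) Q /\ Lp_norm (Q t) @[t --> +oo%R] --> 0%E.

(* Bohr almost periodic functions R -> L^{p(x)}([0,1]:X): for every e > 0 the
   e-periods are relatively dense in R. *)
Definition Lp_almost_periodic (G : R -> (R -> X)) : Prop :=
  Lp_continuous setT G /\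
  (forall e : R, 0 < e -> exists l : R, 0 < l /\
     forall a : R, exists tau : R, a <= tau <= a + l /\
       forall t : R, (Lp_norm (G (t + tau) - G t)%R <= e%:E)%E).

Definition Lp_asymp_almost_periodic (F : R -> (R -> X)) : Prop :=
  Lp_continuous (@half_line R) F /\
  exists G Q : R -> (R -> X),
    Lp_almost_periodic G /\ Lp_C0 Q /\
    (forall t, half_line t -> ae_eq01 (F t) (G t + Q t)).

Definition asymp_S_almost_periodic (f : R -> X) : Prop :=
  LS (@half_line R) f /\ Lp_asymp_almost_periodic (hat f).

Definition S_almost_automorphic (g : R -> X) : Prop :=
  LS setT g /\
  forall a : nat -> R, exists k : nat -> nat, exists h : R -> X,
    {homo k : m n / (m < n)%N} /\ LS setT h /\
    forall t : R,
      Lp_norm (fun x => g (a (k n) + x + t) - h (x + t)) @[n --> \oo]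
        --> 0%E /\
      Lp_norm (fun x => h (x - a (k n) + t) - g (x + t)) @[n --> \oo]
        --> 0%E.

Definition asymp_S_almost_automorphic (f : R -> X) : Prop :=
  LS (@half_line R) f /\
  exists g q : R -> X,
    S_almost_automorphic g /\ LS (@half_line R) q /\
    (forall t : R, 0 <= t -> f t = g t + q t) /\
    Lp_C0 (hat q).

End VariableExponent.

(* Main.v *)
Require Import Defs.
From mathcomp Require Import all_boot all_order all_algebra.
From mathcomp Require Import complex.
From mathcomp Require Import all_classical all_reals all_analysis.
From mathcomp Require Import measurable_realfun.
From mathcomp Require Import ring lra.

(** The almost periodic part [G] of the translates of [f] is a priori only a
    family of classes in the Lebesgue space of the unit interval, while almost
    automorphy speaks of a function [g] on the line. The proof first recovers
    such a [g], then shows that almost periodicity of its translates implies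
    almost automorphy; [q = f - g] is then the vanishing part.

    Both steps need a limit of functions on the line that serves all translates
    of the unit interval at once. It is obtained pointwise almost everywhere. As
    the exponent is at least one, Markov's inequality for the modular and the
    Borel-Cantelli lemma ([ae_geometric_decay]) turn a bound of order [4 ^- n]
    on the Luxemburg norms into almost everywhere convergence, whatever the
    exponent does, and even where it is infinite. The pointwise limit
    ignores how the line is cut into translates, and it is strongly measurable
    because strong measurability survives almost everywhere limits
    ([strongly_measurable_ae_lim], by Egorov's theorem and a diagonal choice).

    Recovering [g] ([exists_base_function]): choose almost periods [tau n] of
    [G], of accuracy of order [4 ^- n], so far out that the vanishing part is of
    this order beyond them. Then [f (tau n + t + .)] converges to [G t] almost
    everywhere, for each [t], so [g y] is the limit of [f (tau n + y)].

    Almost automorphy ([S_almost_periodic_automorphic]): by Bochner's argument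
    ([almost_periodic_subsequence]) every sequence of shifts has a subsequence
    along which the shifted functions are Cauchy in norm, uniformly in the
    translate. Their almost everywhere limit [h] exists as above, and the
    lower semicontinuity of the norm ([Lp_norm_fatou]) makes the convergence to
    [h] uniform in the translate. The uniformity allows the substitution
    [t - a] for [t], which is the second half of the definition. *)

Set Implicit Arguments.
Unset Strict Implicit.
Unset Printing Implicit Defensive.

Import Order.TTheory GRing.Theory Num.Theory.
Import numFieldNormedType.Exports.

Local Open Scope classical_set_scope.
Local Open Scope ring_scope.
Local Open Scope complex_scope.

(** * Lebesgue measurability and null sets *)

Lemma near_half_pow_lt (R : realType) (e : R) : 0 < e ->
  \forall n \near \oo, (2^-1) ^+ n < e.
Proof.
move=> e0; have h1 : `|2^-1 : R| < 1 by rewrite ger0_norm ?invr_ge0//; lra.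
apply: filterS (cvgr0_norm_lt _ (cvg_expr h1) _ e0) => n /=.
by rewrite ger0_norm ?exprn_ge0 ?invr_ge0.
Qed.

Section LebesgueTranslation.
Variable R : realType.

Lemma wlength_shift (A : set R) (t : R) : ocitv A ->
  ocitv [set x : R | A (x + t)%R] /\
  wlength idfun [set x : R | A (x + t)%R] = wlength idfun A :> \bar R.
Proof.
move=> [[a b] _ <-] /=.
have -> : [set x : R | x + t \in `]a, b]] = `]a - t, b - t]%classic.
  by apply/seteqP; split=> x /=; rewrite !in_itv /= ltrBlDr lerBrDr.
split; first exact: is_ocitv.
rewrite !wlength_itv /= !lte_fin ltrD2r.
by case: ifP => // _; rewrite -!EFinB opprB addrA subrK.
Qed.

(** The generators of the outer measure are half-open intervals, so translating
    a cover translates it into a cover with the same lengths. *)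
Lemma outer_measure_shift (A : set R) (t : R) :
  ((wlength idfun)^*%mu [set x : R | A (x + t)%R] = (wlength idfun)^*%mu A)%E.
Proof.
suff H (B : set R) (s : R) :
    ((wlength idfun)^*%mu [set x : R | B (x + s)%R] <=
      (wlength idfun)^*%mu B)%E.
  apply/eqP; rewrite eq_le H /=.
  have := H [set x : R | A (x + t)%R] (- t).
  rewrite [X in (X <= _)%E -> _](_ : _ = (wlength idfun)^*%mu A)//.
  by congr ((wlength idfun)^*%mu _); apply/funext => x /=; rewrite subrK.
apply: le_ereal_inf_tmp => _ [F [mF BF] <-].
apply: ereal_inf_lbound; exists (fun k => [set x : R | F k (x + s)%R]).
  split=> [i|x /= Bx]; first exact: (wlength_shift s (mF i)).1.
  by have [k _ Fk] := BF _ Bx; exists k.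
by congr (limn _); apply/funext => n; apply: eq_bigr => i _;
  rewrite (wlength_shift s (mF i)).2.
Qed.

Lemma measurable_lebesgueR (A : set R) :
  measurable (A : set (lebesgueR R)) <->
  ((wlength idfun)^*%mu : set R -> \bar R).-caratheodory A.
Proof. by []. Qed.

Lemma measurable_shift (A : set R) (t : R) :
  measurable (A : set (lebesgueR R)) ->
  measurable ([set x : R | A (x + t)%R] : set (lebesgueR R)).
Proof.
move=> /measurable_lebesgueR mA; apply/measurable_lebesgueR => Y.
have shiftK (B : set R) : [set x : R | [set y : R | B (y - t)%R] (x + t)%R] = B.
  by apply/funext => x /=; rewrite addrK.
rewrite -[in LHS](shiftK Y) outer_measure_shift mA.
rewrite -(outer_measure_shift (_ `&` A) t).
rewrite -(outer_measure_shift (_ `&` ~` A) t).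
by congr ((wlength idfun)^*%mu (_ `&` _) + (wlength idfun)^*%mu (_ `&` _))%E;
  exact: shiftK.
Qed.

Lemma leb_outerE (A : set (lebesgueR R)) : leb R A = (wlength idfun)^*%mu A.
Proof. by []. Qed.

Lemma ae_shift (P : R -> Prop) (t : R) :
  {ae leb R, forall x : lebesgueR R, P x} ->
  {ae leb R, forall x : lebesgueR R, P ((x : R) + t)}.
Proof.
move=> [N [mN N0 PN]]; exists [set x : R | N (x + t)]; split.
- exact: measurable_shift.
- by rewrite -[RHS]N0 !leb_outerE outer_measure_shift.
- by move=> x /= nP; exact: (PN (x + t)).
Qed.

Lemma measurable_borel_leb (A : set R) :
  measurable (A : set (measurableTypeR R)) ->
  measurable (A : set (lebesgueR R)).
Proof. exact: sub_caratheodory. Qed.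

Lemma unit_interval_measurable : measurable (@unit_interval R).
Proof. by apply: measurable_borel_leb; exact: measurable_itv. Qed.

Lemma ae_forall_nat (P : nat -> R -> Prop) :
  (forall n, {ae leb R, forall x : lebesgueR R, P n x}) ->
  {ae leb R, forall x : lebesgueR R, forall n, P n x}.
Proof.
move=> H; have := negligible_bigcup H.
by apply: negligibleS => x /= /existsNP[n nP]; exists n.
Qed.

(** Countably many translates of the unit interval cover the line. *)
Lemma ae_unit_translates (P : R -> Prop) :
  (forall t : R, {ae leb R, forall x : lebesgueR R,
     unit_interval x -> P (t + (x : R))}) ->
  {ae leb R, forall x : lebesgueR R, P x}.
Proof.
move=> H.
have multiples (s : R) : {ae leb R, forall x : lebesgueR R,
    forall n : nat, unit_interval ((x : R) - s * n%:R) -> P x}.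
  apply: ae_forall_nat => n.
  have := ae_shift (- (s * n%:R)) (H (s * n%:R)).
  by apply: filterS => x; rewrite subrKC.
have := multiples (-1); have := multiples 1.
apply: filterS2 => x P1 P2.
have [x0|x0] := leP 0 x.
  apply: (P1 (Num.truncn x)); rewrite /unit_interval /= in_itv /= mul1r.
  by have /andP[h1 h2] := truncn_itv x0; apply/andP; split; lra.
have x0' : 0 <= - x by lra.
apply: (P2 (Num.truncn (- x)).+1); rewrite /unit_interval /= in_itv /=.
rewrite mulN1r opprK -natr1.
have /andP[h1 h2] := truncn_itv x0'; rewrite -natr1 in h2.
by apply/andP; split; lra.
Qed.

Lemma leb_itv_fin (a b : R) : (leb R [set` `[a, b]] < +oo)%E.
Proof.
rewrite -[leb R _]/(lebesgue_measure [set` `[a, b]]) lebesgue_measure_itv /=.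
by case: ifP => // _; rewrite -EFinB ltry.
Qed.

(** Borel-Cantelli, with a geometric majorant. *)
Lemma ae_eventually_notin (A : nat -> set (lebesgueR R)) :
  (forall n, measurable (A n)) ->
  (\forall n \near \oo, (leb R (A n) <= ((2^-1) ^+ n)%:E)%E) ->
  {ae leb R, forall x : lebesgueR R, \forall n \near \oo, ~ A n x}.
Proof.
move=> mA [N _ HN].
have mL : measurable (lim_sup_set (fun n => A (n + N)%N)).
  by apply: bigcap_measurable => // k _; exact: bigcup_measurable.
have L0 : leb R (lim_sup_set (fun n => A (n + N)%N)) = 0%E.
  apply: lim_sup_set_cvg0 => //.
  apply: (@le_lt_trans _ _ (\sum_(0 <= n <oo) (2^-1 ^+ n)%:E)%E).
    apply: lee_nneseries => // n _.
    apply: (le_trans (HN (n + N)%N _)); first by rewrite /= leq_addl.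
    rewrite lee_fin exprD ler_piMr ?exprn_ge0 ?invr_ge0//.
    by apply: exprn_ile1; rewrite ?invr_ge0//; lra.
  rewrite (_ : (fun _ => _) =
    EFin \o series (geometric 1 (2^-1 : R))); last first.
    apply/funext => n /=; rewrite /series /= sumEFin; congr EFin.
    by apply: eq_bigr => i _; rewrite mul1r.
  have lt1 : `|2^-1 : R| < 1 by rewrite ger0_norm ?invr_ge0//; lra.
  rewrite EFin_lim ?ltry//.
  exact: is_cvg_geometric_series.
exists (lim_sup_set (fun n => A (n + N)%N)); split => // x /= nA n _.
apply: contrapT => nE; apply: nA.
exists (n + N)%N => // m /= nm mAx; apply: nE.
exists (m - N)%N.
  by rewrite /= leq_subRL ?(leq_trans _ nm) ?leq_addl// addnC.
by rewrite /= subnK// (leq_trans _ nm)// leq_addl.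
Qed.

End LebesgueTranslation.
(** * The real-valued norm *)

Section RealNorm.
Variables (R : realType) (X : completeNormedModType R[i]).
Implicit Types u v : X.

Lemma rnormE v : (rnorm v)%:C = `|v|.
Proof. by rewrite /rnorm RRe_real // normr_real. Qed.

Lemma rnorm_ge0 v : 0 <= rnorm v.
Proof. by rewrite -lecR rnormE normr_ge0. Qed.

Lemma rnorm0 : rnorm (0 : X) = 0.
Proof. by rewrite /rnorm normr0. Qed.

Lemma rnormN v : rnorm (- v) = rnorm v.
Proof. by rewrite /rnorm normrN. Qed.

Lemma rnormB u v : rnorm (u - v) = rnorm (v - u).
Proof. by rewrite -rnormN opprB. Qed.

Lemma rnormD u v : rnorm (u + v) <= rnorm u + rnorm v.
Proof. by rewrite -lecR rmorphD /= !rnormE ler_normD. Qed.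

Lemma rnormD_sub u v w : rnorm (u - w) <= rnorm (u - v) + rnorm (v - w).
Proof. by apply: le_trans (rnormD _ _); rewrite subrKA. Qed.

Lemma rnormZ (a : R) v : rnorm (a%:C *: v) = `|a| * rnorm v.
Proof.
apply: (@complexI R); rewrite rmorphM /= !rnormE normrZ normc_def /=.
by rewrite expr0n addr0 sqrtr_sqr.
Qed.

Lemma cvg_rnormP (T : Type) (F : set_system T) {FF : Filter F}
    (f : T -> X) (l : X) :
  f @ F --> l <->
  (forall e : R, 0 < e -> \forall x \near F, rnorm (f x - l) <= e).
Proof.
rewrite cvgrPdistC_le; split=> H e e0.
  have := H e%:C; rewrite ltcR => /(_ e0); apply: filterS => x.
  by rewrite -rnormE lecR.
have er : (complex.Re e)%:C = e by rewrite RRe_real // gtr0_real.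
have := H (complex.Re e); rewrite -ltcR er => /(_ e0); apply: filterS => x.
by rewrite -lecR rnormE er.
Qed.

Lemma cvg_rnorm0P (T : Type) (F : set_system T) {FF : Filter F}
    (f : T -> X) (l : X) :
  f @ F --> l <-> rnorm (f x - l) @[x --> F] --> 0.
Proof.
rewrite cvg_rnormP; split=> [H|/cvgr0Pnorm_le H e e0].
  apply/cvgr0Pnorm_le => e /H; apply: filterS => x.
  by rewrite ger0_norm// rnorm_ge0.
by have := H _ e0; apply: filterS => x; rewrite ger0_norm// rnorm_ge0.
Qed.

Lemma cvg_rnorm (T : Type) (F : set_system T) {FF : Filter F}
    (f : T -> X) (l : X) :
  f @ F --> l -> rnorm (f x) @[x --> F] --> rnorm l.
Proof.
move=> /cvg_rnormP H; apply/cvgrPdistC_le => e /H; apply: filterS => x.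
have := rnormD (f x - l) l; have := rnormD (l - f x) (f x).
rewrite !subrK rnormB => h1 h2 h; rewrite ler_norml; apply/andP; split; lra.
Qed.

Lemma cvg_geometric_increments (u : nat -> X) :
  (\forall n \near \oo, rnorm (u n - u n.+1) <= (2^-1) ^+ n) -> cvgn u.
Proof.
move=> [N _ H].
have tele n k : (N <= n)%N ->
    rnorm (u n - u (n + k)%N) <= 2 * (2^-1 ^+ n - 2^-1 ^+ (n + k)).
  move=> Nn; elim: k => [|k IH]; first by rewrite addn0 !subrr rnorm0 mulr0.
  apply: (le_trans (rnormD_sub _ (u (n + k)%N) _)).
  have Hk : rnorm (u (n + k)%N - u (n + k.+1)%N) <= 2^-1 ^+ (n + k).
    by rewrite addnS; apply: H; rewrite /= (leq_trans Nn)// leq_addr.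
  apply: (le_trans (lerD IH Hk)); rewrite addnS exprS.
  by set x := _ ^+ (n + k); lra.
apply/cauchy_cvgP/cauchy_exP => e e0.
have er : (complex.Re e)%:C = e by rewrite RRe_real // gtr0_real.
have re0 : 0 < complex.Re e / 2 by rewrite divr_gt0// -ltcR er.
have [M _ HM] := near_half_pow_lt re0.
have {HM} := HM (maxn N M) (leq_maxr _ _).
set n := maxn N M; rewrite /= => HM.
exists (u n), n => // m /= nm; rewrite -ball_normE /= -rnormE -er ltcR.
rewrite -(subnKC nm); apply: (le_lt_trans (tele _ _ (leq_maxl _ _))).
have : 0 <= (2^-1 : R) ^+ (n + (m - n)) by rewrite exprn_ge0 ?invr_ge0.
by move: HM; set x := _ ^+ (n + _); set y := _ ^+ n; lra.
Qed.

End RealNorm.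
(** * Strongly measurable functions *)

Section SimpleFunctions.
Variable R : realType.

(** The condition on each member of the approximating sequence in
    [strongly_measurable], for values in any type, so that it also applies to
    the norms of the members. *)
Definition simple_on (Y : Type) (D : set R) (s : R -> Y) : Prop :=
  finite_set (s @` D) /\
  forall v, measurable ((D `&` s @^-1` [set v]) : set (lebesgueR R)).

Lemma simple_on_comp2 (Y Z W : Type) (op : Y -> Z -> W) (D : set R) s s' :
  simple_on D s -> simple_on D s' -> simple_on D (fun x => op (s x) (s' x)).
Proof.
move=> [fs ms] [fs' ms']; split.
  apply: (@sub_finite_set _ _ (image2 (s @` D) (s' @` D) op)).
    by move=> _ [x Dx <-]; exists (s x); [exists x|exists (s' x); [exists x|]].
  exact: finite_image2.
move=> v.
pose P := [set ab : Y * Z |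
  (s @` D) ab.1 /\ (s' @` D) ab.2 /\ op ab.1 ab.2 = v].
have -> : D `&` (fun x => op (s x) (s' x)) @^-1` [set v] =
    \bigcup_(ab in P)
      ((D `&` s @^-1` [set ab.1]) `&` (D `&` s' @^-1` [set ab.2])).
  apply/seteqP; split=> [x [Dx /= xv]|x [[a b] [_ [_ /= abv]]]].
    by exists (s x, s' x); split => //=; [exists x|split => //; exists x].
  by move=> [[Dx /= ->] [_ /= ->]].
apply: (@fin_bigcup_measurable _ (lebesgueR R)) => [|ab _].
  apply: (@sub_finite_set _ _ ((s @` D) `*` (s' @` D))).
    by move=> [a b] [? []].
  exact: finite_setX.
exact: measurableI.
Qed.

Lemma simple_on_measurable (D : set R) (s : R -> R) :
  simple_on D s -> measurable_fun (D : set (lebesgueR R)) s.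
Proof.
move=> [fs ms] _ B mB.
have -> : D `&` s @^-1` B =
    \bigcup_(v in (s @` D) `&` B) (D `&` s @^-1` [set v]).
  apply/seteqP; split=> [x [Dx Bx]|x [v [_ Bv]] [Dx /= sx]].
    by exists (s x) => //; split => //; exists x.
  by split => //=; rewrite sx.
apply: (@fin_bigcup_measurable _ (lebesgueR R)) => //.
by apply: sub_finite_set fs => x [].
Qed.

(** Completeness of the measure makes an almost everywhere limit measurable. *)
Lemma measurable_fun_ae_lim (D : set R) (g : nat -> R -> R) (w : R -> R) :
  (forall n, measurable_fun (D : set (lebesgueR R)) (g n)) ->
  {ae leb R, forall x : lebesgueR R, D x -> g n x @[n --> \oo] --> w x} ->
  measurable_fun (D : set (lebesgueR R)) w.
Proof.
move=> mg gw; apply/measurable_EFinP.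
apply: (@ae_measurable_fun _ _ _ (leb R) _ _
  (fun x => limn_esup (fun n => (g n x)%:E))).
- exact: completed_lebesgue_measure_is_complete.
- apply: filterS gw => x gw Dx.
  have cg : (g n x)%:E @[n --> \oo] --> (w x)%:E.
    by apply: cvg_EFin; [exact: nearW|exact: gw].
  rewrite is_cvg_limn_esupE; first exact/cvg_lim.
  by apply/cvg_ex; exists (w x)%:E; exact: cg.
- by apply: measurable_fun_limn_esup => n; apply/measurable_EFinP.
Qed.

End SimpleFunctions.

Section StronglyMeasurable.
Variables (R : realType) (X : completeNormedModType R[i]).
Implicit Types (D : set R) (u v : R -> X).

Lemma simple_on_strongly_measurable D u :
  simple_on D u -> strongly_measurable D u.
Proof.
by move=> su; exists (fun=> u); split => //; apply: aeW => x _; exact: cvg_cst.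
Qed.

Lemma strongly_measurableS D D' u :
  measurable (D' : set (lebesgueR R)) -> D' `<=` D ->
  strongly_measurable D u -> strongly_measurable D' u.
Proof.
move=> mD' DD' [s [ss su]]; exists s; split; last first.
  by apply: filterS su => x H /DD'.
move=> n; have [fs ms] := ss n; split.
  by apply: sub_finite_set fs; exact: image_subset.
move=> v; rewrite (_ : _ `&` _ = D' `&` (D `&` s n @^-1` [set v])).
  exact: measurableI.
by rewrite setIA (setIidl DD').
Qed.

Lemma strongly_measurableB D u v :
  strongly_measurable D u -> strongly_measurable D v ->
  strongly_measurable D (u - v).
Proof.
move=> [s [ss su]] [s' [ss' su']].
exists (fun n x => s n x - s' n x); split=> [n|].
  exact: (simple_on_comp2 (fun a b : X => a - b)).
by apply: filterS2 su su' => x H H' Dx; apply: cvgB; auto.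
Qed.

Lemma strongly_measurable_shift D u (t : R) :
  strongly_measurable D u ->
  strongly_measurable [set x | D (x + t)] (fun x => u (x + t)).
Proof.
move=> [s [ss su]]; exists (fun n x => s n (x + t)); split=> [n|].
  have [fs ms] := ss n; split.
    by apply: sub_finite_set fs => _ [x Dx <-]; exists (x + t).
  by move=> v; exact: (measurable_shift t (ms v)).
exact: (ae_shift t su).
Qed.

Lemma strongly_measurable_extend0 D u :
  measurable (D : set (lebesgueR R)) -> strongly_measurable D u ->
  strongly_measurable setT (fun x => if x \in D then u x else 0).
Proof.
move=> mD [s [ss su]].
exists (fun n x => if x \in D then s n x else 0); split=> [n|]; last first.
  apply: filterS su => x H _; case: ifPn => xD; last exact: cvg_cst.
  by apply: H; rewrite inE in xD.
have [fs ms] := ss n; split.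
  apply: (@sub_finite_set _ _ (s n @` D `|` [set 0])).
    move=> _ [x _ <-]; case: ifPn => [|_]; last by right.
    by rewrite inE => Dx; left; exists x.
  by rewrite finite_setU; split => //; exact: finite_set1.
move=> v; rewrite setTI.
have -> : (fun x => if x \in D then s n x else 0) @^-1` [set v] =
    (D `&` s n @^-1` [set v]) `|` (~` D `&` [set _ | 0 = v]).
  apply/seteqP; split=> [x /=|x /=]; case: ifPn; rewrite ?inE ?notin_setE.
  - by left.
  - by right.
  - by move=> Dx [[]//|[]].
  - by move=> Dx [[]//|[]].
apply: measurableU => //; apply: measurableI; first exact: measurableC.
have [->|v0] := eqVneq v 0.
  by rewrite (_ : [set _ | _] = setT)//; apply/funext => x; apply/propext.
by rewrite (_ : [set _ | _] = set0)//; apply/seteqP; split=> // x /= /esym/eqP;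
  rewrite (negbTE v0).
Qed.

Lemma measurable_rnormB D u v :
  strongly_measurable D u -> strongly_measurable D v ->
  measurable_fun (D : set (lebesgueR R)) (fun x => rnorm (u x - v x)).
Proof.
move=> [s [ss su]] [s' [ss' su']].
apply: (@measurable_fun_ae_lim _ _ (fun n x => rnorm (s n x - s' n x))).
  move=> n; apply: simple_on_measurable.
  exact: (simple_on_comp2 (fun a b : X => rnorm (a - b))).
apply: filterS2 su su' => x H H' Dx; apply: cvg_rnorm.
by apply: cvgB; auto.
Qed.

Lemma measurable_rnorm D u :
  strongly_measurable D u ->
  measurable_fun (D : set (lebesgueR R)) (fun x => rnorm (u x)).
Proof.
move=> su; have := measurable_rnormB su (strongly_measurableB su su).
by under eq_fun do rewrite /= subrr subr0.
Qed.

(** On each bounded interval almost everywhere convergence gives convergence in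
    measure, so a diagonal sequence of simple functions can be chosen whose
    error sets are summable. *)
Lemma strongly_measurable_ae_lim D (u_ : nat -> R -> X) u :
  measurable (D : set (lebesgueR R)) ->
  (forall k, strongly_measurable D (u_ k)) ->
  {ae leb R, forall x : lebesgueR R, D x -> u_ k x @[k --> \oo] --> u x} ->
  strongly_measurable D u.
Proof.
move=> mD su cu.
have approx k : exists s : R -> X, exists A : set R,
   [/\ simple_on D s, measurable (A : set (lebesgueR R)),
       (leb R A <= (2^-1 ^+ k)%:E)%E &
       forall x, D x -> `|x| <= k%:R -> ~ A x ->
         rnorm (s x - u_ k x) <= 2^-1 ^+ k].
  have [s [ss sk]] := su k.
  pose E : set (lebesgueR R) := D `&` [set` `[- k%:R : R, k%:R]].
  have mE : measurable E.
    apply: measurableI => //.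
    by apply: measurable_borel_leb; exact: measurable_itv.
  have finE : (leb R E < +oo)%E.
    apply: le_lt_trans (leb_itv_fin (- k%:R : R) k%:R).
    apply: le_measure; rewrite ?inE//; last by move=> x [].
    by apply: measurable_borel_leb; exact: measurable_itv.
  have mf n : measurable_fun E (fun x => rnorm (s n x - u_ k x)).
    apply: (measurable_funS mD); first by move=> x [].
    apply: measurable_rnormB (su k).
    exact: simple_on_strongly_measurable (ss n).
  have cf : {ae leb R, forall x : lebesgueR R, E x ->
      rnorm (s n x - u_ k x) @[n --> \oo] --> (cst 0 : R -> R) x}.
    by apply: filterS sk => x H [Dx _]; apply/cvg_rnorm0P; exact: H.
  have half0 : 0 < (2^-1 : R) ^+ k by rewrite exprn_gt0 ?invr_gt0.
  have [A [mA /ltW A2 unif]] :=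
    ae_pointwise_almost_uniform mf (measurable_cst (0 : R)) mE finE cf half0.
  have [N _ HN] : \forall n \near \oo, forall x, (E `\` A) x ->
      rnorm (s n x - u_ k x) <= 2^-1 ^+ k.
    apply: (unif [set h : R -> R | forall x, (E `\` A) x -> h x <= 2^-1 ^+ k]).
    apply/uniform_nbhs.
    exists [set xy | ball xy.1 (2^-1 ^+ k : R) xy.2].
    split; first exact: entourage_ball (PosNum half0).
    move=> h /= Hh x EAx; have := Hh x EAx; rewrite /ball /= sub0r normrN.
    by move/ltW; apply: le_trans; exact: ler_norm.
  exists (s N), A; split => // x Dx xk nAx; apply: HN; rewrite /= ?leqnn//.
  by split => //; split => //=; rewrite in_itv /= -ler_norml.
have /choice[s /choice[A sA]] := approx.
exists s; split=> [n|]; first by have [] := sA n.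
have : {ae leb R, forall x : lebesgueR R, \forall n \near \oo, ~ A n x}.
  by apply: ae_eventually_notin => [n|]; [have [] := sA n|
    apply: nearW => n; have [] := sA n].
apply: filterS2 cu => x cu Ax Dx; apply/cvg_rnormP => e e0.
have e20 : 0 < e / 2 by rewrite divr_gt0.
have xk : \forall n \near \oo, `|x : R| <= n%:R.
  by exists (Num.truncn `|x : R|).+1 => // n /= xn;
    apply: (le_trans (ltW (truncnS_gt _))); rewrite ler_nat.
near=> n; apply: (le_trans (rnormD_sub _ (u_ n x) _)).
rewrite [leRHS]splitr lerD//.
  have [_ _ _ sAn] := sA n.
  apply: (le_trans (sAn _ Dx _ _)); [by near: n|by near: n|].
  by apply: ltW; near: n; exact: near_half_pow_lt.
by near: n; move/cvg_rnormP: (cu Dx); exact.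
Unshelve. all: by end_near. Qed.

End StronglyMeasurable.
(** * The modular and the Luxemburg norm *)

Section ExponentFunction.
Variable R : realType.
Implicit Types (q : \bar R) (a b s t : R).

Lemma varphi_ge0 q t : (0 <= varphi q t)%E.
Proof.
by case: q => [r| |] //=; [rewrite lee_fin powR_ge0|case: ifP].
Qed.

Lemma varphi0 q : (1 <= q)%E -> varphi q 0 = 0%E.
Proof.
case: q => [r| |] //=; last by rewrite ler01.
by rewrite lee_fin => r1; rewrite powR0// gt_eqF// (lt_le_trans ltr01).
Qed.

Lemma varphi_le q s t : (1 <= q)%E -> 0 <= s -> s <= t ->
  (varphi q s <= varphi q t)%E.
Proof.
case: q => [r| |] //= q1 s0 st.
  rewrite lee_fin in q1; rewrite lee_fin ge0_ler_powR// ?nnegrE//; lra.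
case: ifP => [_|]; first by case: ifP.
by move=> /negbT; rewrite -ltNge => s1; rewrite (leNgt t) (lt_le_trans s1 st).
Qed.

Lemma varphi_ge_id q t : (1 <= q)%E -> 1 < t -> (t%:E <= varphi q t)%E.
Proof.
case: q => [r| |] //= q1 t1; last by rewrite (leNgt t) t1 leey.
by rewrite lee_fin in q1; rewrite lee_fin le1r_powR// ltW.
Qed.

Lemma varphi_convex q a b s t : (1 <= q)%E -> 0 < a -> 0 < b -> a + b = 1 ->
  0 <= s -> 0 <= t ->
  (varphi q (a * s + b * t) <= a%:E * varphi q s + b%:E * varphi q t)%E.
Proof.
case: q => [r| |] //= q1 a0 b0 ab s0 t0.
  rewrite lee_fin in q1; rewrite -!EFinM -EFinD lee_fin.
  have a01 : 0 <= a <= 1 by apply/andP; split; lra.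
  have /andP[a0' a1'] := a01.
  pose i := Itv01 a0' a1'.
  have := convex_powR q1 i; move=> /(_ s t).
  rewrite !inE /= !in_itv /= !andbT => /(_ s0 t0).
  have onemE : unstable.onem a = b by rewrite /unstable.onem; lra.
  by rewrite convRE [X in X `^ _ <= _ -> _]convRE /= onemE.
have [s1|_] := leP s 1; have [t1|_] := leP t 1.
- rewrite !mule0 adde0 ifT//.
  have := ler_wpM2l (ltW a0) s1; have := ler_wpM2l (ltW b0) t1; lra.
- by rewrite mule0 add0e gt0_muley ?lte_fin// leey.
- by rewrite mule0 adde0 gt0_muley ?lte_fin// leey.
- by rewrite !gt0_muley ?lte_fin// addye// leey.
Qed.

End ExponentFunction.

Section Modular.
Variables (R : realType) (p : R -> \bar R).
Hypothesis hp : variable_exponent p.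

Local Notation U := (@unit_interval R).

Let mU : measurable U. Proof. exact: unit_interval_measurable. Qed.

Let p1 x : U x -> (1 <= p x)%E. Proof. exact: hp.2. Qed.

(** The exponential formula for real powers is measurable in base and exponent
    jointly; infinite exponents are split off. *)
Lemma measurable_varphi (w : R -> R) :
  measurable_fun U (w : lebesgueR R -> R) ->
  measurable_fun U ((fun x => varphi (p x) (w x)) : lebesgueR R -> \bar R).
Proof.
move=> mw.
have mp : measurable_fun U (p : lebesgueR R -> \bar R) := hp.1.
pose F (x : lebesgueR R) := if p x == +oo%E then
   (if w x <= 1 then 0%E else +oo%E)
   else (if w x == 0 then 0 else expR (fine (p x) * ln (w x)))%:E.
apply: (@eq_measurable_fun _ _ _ _ _ F).
  move=> x; rewrite inE => Ux; have := p1 Ux.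
  rewrite /F /varphi /powR; case: (p x) => [r| |]//=; rewrite lee_fin => r1.
  by rewrite (gt_eqF (lt_le_trans ltr01 r1)).
have mfp : measurable_fun U (fun x : lebesgueR R => fine (p x)).
  exact: measurableT_comp mp.
have m1 : measurable_fun U (fun x : lebesgueR R =>
    if w x <= 1 then 0%E else +oo%E : \bar R).
  apply: (measurable_fun_if mU); [|exact: measurable_cst|exact: measurable_cst].
  exact: measurable_fun_ler mw (measurable_cst _).
have m2 : measurable_fun U (fun x : lebesgueR R =>
    if w x == 0 then 0 else expR (fine (p x) * ln (w x))).
  apply: (measurable_fun_if mU).
  - exact: measurable_fun_eqr mw (measurable_cst _).
  - exact: measurable_cst.
  - apply: (measurable_funS mU (@subIsetl _ _ _)).
    have mlnw := measurableT_comp (@measurable_ln R) mw.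
    exact: measurableT_comp (@measurable_expR R) (measurable_funM mfp mlnw).
apply: (measurable_fun_if mU).
- exact: measurable_fun_eqe mp (measurable_cst _).
- exact: (measurable_funS mU (@subIsetl _ _ _) m1).
- apply: (measurable_funS mU (@subIsetl _ _ _)).
  by apply/measurable_EFinP.
Qed.

(** The condition for [l] to enter the infimum that defines the Luxemburg norm,
    read off the pointwise norm [w]: the Luxemburg norm depends on a vector
    valued function through [w] only. *)
Definition admissible (w : R -> R) (l : R) : Prop :=
  0 < l /\ (\int[leb R]_(x in U) varphi (p x) (l^-1 * w x) <= 1)%E.

Definition nonneg_meas (w : R -> R) : Prop :=
  measurable_fun U (w : lebesgueR R -> R) /\ forall x, 0 <= w x.

Let nonneg_measV w l :
  nonneg_meas w -> 0 < l -> nonneg_meas (fun x => l^-1 * w x).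
Proof.
move=> [mw w0] l0; split; first exact: measurable_funM (measurable_cst _) mw.
by move=> x; rewrite mulr_ge0// invr_ge0 ltW.
Qed.

Lemma admissible_le w1 w2 l m : nonneg_meas w1 -> nonneg_meas w2 ->
  {ae leb R, forall x : lebesgueR R, U x -> w1 x <= w2 x} ->
  l <= m -> admissible w2 l -> admissible w1 m.
Proof.
move=> w1P w2P w12 lm [l0 H]; have m0 : 0 < m by lra.
split=> //; apply: le_trans H.
apply: (ae_ge0_le_integral mU).
- by move=> x _; exact: varphi_ge0.
- by apply: measurable_varphi; exact: (nonneg_measV w1P m0).1.
- by move=> x _; exact: varphi_ge0.
- by apply: measurable_varphi; exact: (nonneg_measV w2P l0).1.
apply: filterS w12 => x H Ux; apply: varphi_le; first exact: p1.
  exact: (nonneg_measV w1P m0).2.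
by rewrite ler_pM ?invr_ge0 ?(ltW m0) ?w1P.2 ?H// lef_pV2.
Qed.

(** Convexity of the integrand, with the weights [l / (l + m)] and
    [m / (l + m)]: this is the triangle inequality for the Luxemburg norm. *)
Lemma admissibleD w1 w2 l m : nonneg_meas w1 -> nonneg_meas w2 ->
  admissible w1 l -> admissible w2 m ->
  admissible (fun x => w1 x + w2 x) (l + m).
Proof.
move=> w1P w2P [l0 H1] [m0 H2]; have lm0 : 0 < l + m by lra.
split=> //.
pose a := l / (l + m); pose b := m / (l + m).
have a0 : 0 < a by rewrite divr_gt0.
have b0 : 0 < b by rewrite divr_gt0.
have ab : a + b = 1 by rewrite /a /b -mulrDl divff// gt_eqF.
have mV w c : nonneg_meas w -> 0 < c -> measurable_fun U
    (fun x : lebesgueR R => varphi (p x) (c^-1 * w x)).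
  by move=> wP c0; apply: measurable_varphi; exact: (nonneg_measV wP c0).1.
have V0 (w : R -> R) c x : U x -> (0 <= varphi (p x) (c^-1 * w x))%E.
  by move=> _; exact: varphi_ge0.
apply: (@le_trans _ _ (\int[leb R]_(x in U)
   (a%:E * varphi (p x) (l^-1 * w1 x) + b%:E * varphi (p x) (m^-1 * w2 x)))%E).
  apply: (ge0_le_integral _ mU).
  - by move=> x _; exact: varphi_ge0.
  - apply: measurable_varphi; apply: measurable_funM (measurable_cst _) _.
    exact: measurable_funD w1P.1 w2P.1.
  - by apply: emeasurable_funD; apply: measurable_funeM; apply: mV.
  move=> x Ux; rewrite (_ : _ * _ = a * (l^-1 * w1 x) + b * (m^-1 * w2 x)).
    by apply: varphi_convex => //; [exact: p1|exact: (nonneg_measV w1P l0).2|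
      exact: (nonneg_measV w2P m0).2].
  rewrite /a /b; field; rewrite ?gt_eqF//.
rewrite (ge0_integralD _ mU); last first.
- by apply: measurable_funeM; exact: mV.
- by move=> x Ux; rewrite mule_ge0 ?V0 ?lee_fin ?ltW.
- by apply: measurable_funeM; exact: mV.
- by move=> x Ux; rewrite mule_ge0 ?V0 ?lee_fin ?ltW.
have scale (c d : R) v : nonneg_meas v -> 0 < c -> 0 < d ->
    (\int[leb R]_(x in U) varphi (p x) (d^-1 * v x) <= 1)%E ->
    (\int[leb R]_(x in U) (c%:E * varphi (p x) (d^-1 * v x)) <= c%:E)%E.
  move=> vP c0 d0 H.
  rewrite (ge0_integralZl_EFin _ mU (V0 v d) (mV v d vP d0) (ltW c0)).
  by rewrite -[leRHS]mule1 lee_pmul2l ?lte_fin.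
have -> : 1%E = (a%:E + b%:E)%E by rewrite -EFinD ab.
by apply: leeD; apply: scale.
Qed.

(** Markov's inequality: above the level [l], the integrand of the modular
    dominates [w x / l], since the exponent is at least one. *)
Lemma admissible_markov w l K : nonneg_meas w -> admissible w l -> 1 <= K ->
  (K%:E * leb R (U `&` [set x | (K * l < w x)%R]) <= 1)%E.
Proof.
move=> wP [l0 H] K1; apply: le_trans H.
set A := U `&` _.
have mA : measurable (A : set (lebesgueR R)).
  rewrite (_ : A = U `&` w @^-1` `]K * l, +oo[).
    apply: wP.1 => //.
  by apply/seteqP; split=> x [Ux /=]; rewrite in_itv /= andbT.
have mV : measurable_fun U (fun x : lebesgueR R => varphi (p x) (l^-1 * w x)).
  by apply: measurable_varphi; exact: (nonneg_measV wP l0).1.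
apply: (@le_trans _ _ (\int[leb R]_(x in A) varphi (p x) (l^-1 * w x))%E);
  last first.
  apply: (ge0_subset_integral _ mA mU mV); last by move=> x [].
  by move=> x _; exact: varphi_ge0.
rewrite -(integral_cst _ mA); apply: (ge0_le_integral _ mA).
- by move=> x _; rewrite lee_fin; lra.
- exact: measurable_cst.
- by apply: (measurable_funS mU _ mV) => x [].
move=> x [Ux /= Kw]; have Kw' : K < l^-1 * w x by rewrite mulrC ltr_pdivlMr.
apply: (@le_trans _ _ (l^-1 * w x)%:E); first by rewrite lee_fin ltW.
by apply: varphi_ge_id; [exact: p1|lra].
Qed.

(** Monotonicity of the integrand replaces its lower semicontinuity: dividing
    the limit by a constant [m > l] puts it eventually below the sequence. *)
Lemma admissible_fatou (w_ : nat -> R -> R) w l m :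
  (forall n, nonneg_meas (w_ n)) -> nonneg_meas w ->
  {ae leb R, forall x : lebesgueR R, U x -> w_ n x @[n --> \oo] --> w x} ->
  (forall n, admissible (w_ n) l) -> l < m -> admissible w m.
Proof.
move=> w_P wP cw Hl lm; have l0 : 0 < l := (Hl 0).1; have m0 : 0 < m by lra.
split=> //.
have mV v c : nonneg_meas v -> 0 < c -> measurable_fun U
    (fun x : lebesgueR R => varphi (p x) (c^-1 * v x)).
  by move=> vP c0; apply: measurable_varphi; exact: (nonneg_measV vP c0).1.
pose f n (x : lebesgueR R) := varphi (p x) (l^-1 * w_ n x).
have mf n : measurable_fun U (f n) by exact: mV.
have f0 n x : U x -> (0 <= f n x)%E by move=> _; exact: varphi_ge0.
apply: (@le_trans _ _ (\int[leb R]_(x in U) limn_einf (f ^~ x))%E).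
  apply: (ae_ge0_le_integral mU).
  - by move=> x _; exact: varphi_ge0.
  - exact: mV.
  - move=> x Ux; rewrite limn_einf_lim.
    apply: lime_ge; first exact: is_cvg_einfs.
    apply: nearW => n; apply: le_ereal_inf_tmp => _ [k _ <-]; exact: f0.
  - apply: (emeasurable_fun_cvg (fun n x => einfs (f ^~ x) n)) => [n|x _].
      exact: measurable_fun_einfs mf n.
    by rewrite limn_einf_lim; exact: is_cvg_einfs.
  apply: filterS cw => x cw Ux.
  have [N _ HN] : \forall n \near \oo, (varphi (p x) (m^-1 * w x) <= f n x)%E.
    have := wP.2 x; rewrite le_eqVlt => /predU1P[<-|wx0].
      by apply: nearW => n; rewrite mulr0 varphi0 ?f0//; exact: p1.
    have lt : l / m * w x < w x by rewrite gtr_pMl// ltr_pdivrMr// mul1r.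
    have [N _ HN] := cvgr_gt _ (cw Ux) _ lt.
    exists N => // n Nn; have {HN}/= Hn := HN n Nn.
    apply: (varphi_le (p1 Ux)); first by have [_] := nonneg_measV wP m0; apply.
    rewrite (_ : m^-1 * w x = l^-1 * (l / m * w x)).
      by rewrite ler_wpM2l ?invr_ge0 ?(ltW l0)// ltW.
    by rewrite !mulrA mulVf ?gt_eqF// mul1r.
  rewrite limn_einf_lim; apply: lime_ge; first exact: is_cvg_einfs.
  exists N => // n /= Nn; apply: le_ereal_inf_tmp => _ [k /= nk <-].
  by apply: HN; rewrite /= (leq_trans Nn).
apply: le_trans (fatou _ mU mf f0) _.
rewrite limn_einf_lim; apply: lime_le; first exact: is_cvg_einfs.
apply: nearW => n; apply: (@le_trans _ _ (\int[leb R]_(x in U) f n x)%E).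
  by apply: ereal_inf_lbound; exists n => //; exact: leqnn.
exact: (Hl n).2.
Qed.

End Modular.
Section LuxemburgNorm.
Variables (R : realType) (X : completeNormedModType R[i]) (p : R -> \bar R).
Hypothesis hp : variable_exponent p.
Implicit Types u v w : R -> X.

Local Notation U := (@unit_interval R).
Local Notation admissible u l := (admissible p (fun x => rnorm (u x)) l).

Let nonneg_rnorm u :
  strongly_measurable U u -> nonneg_meas (fun x => rnorm (u x)).
Proof.
by move=> su; split=> [|x]; [exact: measurable_rnorm|exact: rnorm_ge0].
Qed.

Lemma admissibleE u l : 0 < l ->
  rho p (fun x => l^-1%:C *: u x) =
  (\int[leb R]_(x in U) varphi (p x) (l^-1 * rnorm (u x)))%E.
Proof.
move=> l0; rewrite /rho; apply: eq_integral => x _.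
by rewrite rnormZ ger0_norm// invr_ge0 ltW.
Qed.

Lemma Lp_norm_ge0 u : (0 <= Lp_norm p u)%E.
Proof.
by apply: le_ereal_inf_tmp => _ [l /= [l0 _] <-]; rewrite lee_fin ltW.
Qed.

Lemma Lp_norm_le u l : admissible u l -> (Lp_norm p u <= l%:E)%E.
Proof.
move=> [l0 H]; apply: ereal_inf_lbound; exists l => //=; split=> //.
by rewrite admissibleE.
Qed.

Lemma Lp_norm_lt u l : strongly_measurable U u -> (Lp_norm p u < l%:E)%E ->
  admissible u l.
Proof.
move=> su /ereal_inf_lt[_ [m /= [m0 Hm] <-]]; rewrite lte_fin => ml.
apply: (admissible_le hp (nonneg_rnorm su) (nonneg_rnorm su) _ (ltW ml)).
  by apply: aeW => x _.
by split=> //; rewrite -admissibleE.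
Qed.

(** Comparing pointwise norms, rather than functions, covers sums, differences
    and signs at once. *)
Lemma Lp_norm_triangle u v w :
  strongly_measurable U u -> strongly_measurable U v ->
  strongly_measurable U w ->
  {ae leb R, forall x : lebesgueR R, U x ->
     rnorm (u x) <= rnorm (v x) + rnorm (w x)} ->
  (Lp_norm p u <= Lp_norm p v + Lp_norm p w)%E.
Proof.
move=> su sv sw uvw.
have := Lp_norm_ge0 v; have := Lp_norm_ge0 w.
have vE := @Lp_norm_lt v; have wE := @Lp_norm_lt w.
case: (Lp_norm p w) wE => [b| |] // wE;
  case: (Lp_norm p v) vE => [a| |] // vE b0 a0; rewrite ?addye ?addey ?leey//.
apply/lee_addgt0Pr => e e0; rewrite -!EFinD.
have e20 : 0 < e / 2 by rewrite divr_gt0.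
have va : admissible v (a + e / 2) by apply: vE => //; rewrite lte_fin ltrDl.
have wb : admissible w (b + e / 2) by apply: wE => //; rewrite lte_fin ltrDl.
apply: Lp_norm_le.
apply: (admissible_le hp (nonneg_rnorm su) _ uvw _
  (admissibleD hp (nonneg_rnorm sv) (nonneg_rnorm sw) va wb)); last lra.
have [mv v0] := nonneg_rnorm sv; have [mw w0] := nonneg_rnorm sw.
by split=> [|x]; [exact: measurable_funD|rewrite addr_ge0].
Qed.

Lemma Lp_norm_ae_le u v :
  strongly_measurable U u -> strongly_measurable U v ->
  {ae leb R, forall x : lebesgueR R, U x -> rnorm (u x) <= rnorm (v x)} ->
  (Lp_norm p u <= Lp_norm p v)%E.
Proof.
move=> su sv uv; have := Lp_norm_ge0 v; have vE := @Lp_norm_lt v.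
case: (Lp_norm p v) vE => [a| |] // vE a0; last exact: leey.
apply/lee_addgt0Pr => e e0; rewrite -EFinD; apply: Lp_norm_le.
have va : admissible v (a + e) by apply: vE => //; rewrite lte_fin ltrDl.
exact: (admissible_le hp (nonneg_rnorm su) (nonneg_rnorm sv) uv (lexx _) va).
Qed.

Lemma Lp_norm_ae_eq u v :
  strongly_measurable U u -> strongly_measurable U v -> ae_eq01 u v ->
  Lp_norm p u = Lp_norm p v.
Proof.
move=> su sv uv; apply/eqP; rewrite eq_le !Lp_norm_ae_le//;
  by apply: filterS uv => x uv Ux; rewrite uv.
Qed.

Lemma Lp_of_norm u : strongly_measurable U u -> (Lp_norm p u < +oo)%E -> Lp p u.
Proof.
move=> su uoo; split => //.
have [_ [l /= [l0 ul] _] _] := ereal_inf_lt uoo.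
exists l^-1; split; first by rewrite invr_gt0.
by apply: le_lt_trans ul _; rewrite ltry.
Qed.

(** Lower semicontinuity replaces completeness of the space: it bounds the
    distance to an almost everywhere limit of a Cauchy sequence. *)
Lemma Lp_norm_fatou (u_ : nat -> R -> X) u (c : R) :
  (forall n, strongly_measurable U (u_ n)) -> strongly_measurable U u ->
  {ae leb R, forall x : lebesgueR R, U x -> u_ n x @[n --> \oo] --> u x} ->
  (\forall n \near \oo, (Lp_norm p (u_ n) <= c%:E)%E) ->
  (Lp_norm p u <= c%:E)%E.
Proof.
move=> su_ su cu [N _ HN]; apply/lee_addgt0Pr => e e0; rewrite -EFinD.
have e20 : 0 < e / 2 by rewrite divr_gt0.
apply: Lp_norm_le.
apply: (admissible_fatou hp (w_ := fun n x => rnorm (u_ (n + N)%N x))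
  (l := c + e / 2)).
- by move=> n; exact: nonneg_rnorm.
- exact: nonneg_rnorm.
- apply: filterS cu => x cu Ux; apply: cvg_rnorm.
  by rewrite (cvg_shiftn N (fun n => u_ n x)); exact: cu.
- move=> n; apply: Lp_norm_lt => //; apply: (le_lt_trans (HN _ _)).
    by rewrite /= leq_addl.
  by rewrite lte_fin ltrDl.
- lra.
Qed.

(** Markov's inequality, at [2 ^ n] times the norm, bounds the measure of the
    set where the [n]-th function exceeds [2 ^- n] by [2 ^- n], and these bounds
    are summable. *)
Lemma ae_geometric_decay (u_ : nat -> R -> X) :
  (forall n, strongly_measurable U (u_ n)) ->
  (\forall n \near \oo,
     (Lp_norm p (u_ n) < ((2^-1) ^+ n * (2^-1) ^+ n)%:E)%E) ->
  {ae leb R, forall x : lebesgueR R, U x ->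
     \forall n \near \oo, rnorm (u_ n x) <= (2^-1) ^+ n}.
Proof.
move=> su_ Hu.
pose A n : set (lebesgueR R) := U `&` [set x | 2^-1 ^+ n < rnorm (u_ n x)].
have : {ae leb R, forall x : lebesgueR R, \forall n \near \oo, ~ A n x}.
  apply: ae_eventually_notin => [n|].
    rewrite (_ : A n = U `&` (fun x => rnorm (u_ n x)) @^-1` `]2^-1 ^+ n, +oo[).
      by apply: (nonneg_rnorm (su_ n)).1 => //; exact: unit_interval_measurable.
    by apply/seteqP; split=> x [Ux /=]; rewrite in_itv /= andbT.
  apply: filterS Hu => n Hn.
  have h0 : 0 < (2^-1 : R) ^+ n by rewrite exprn_gt0 ?invr_gt0.
  have K1 : 1 <= (2 : R) ^+ n by rewrite exprn_ege1 ?ler1n.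
  have := admissible_markov hp (nonneg_rnorm (su_ n))
    (Lp_norm_lt (su_ n) Hn) K1.
  rewrite mulrA -exprMn divff ?pnatr_eq0// expr1n mul1r => H.
  rewrite -(@lee_pmul2l _ (2 ^+ n)%:E) ?lte_fin ?exprn_gt0//.
  by rewrite -EFinM -exprMn divff ?pnatr_eq0// expr1n.
apply: filterS => x Ax Ux; apply: filterS Ax => n nA.
by rewrite leNgt; apply/negP => H; apply: nA.
Qed.

End LuxemburgNorm.
(** * Bochner's compactness criterion *)

Section Bochner.
Variables (R : realType) (d : R -> R -> \bar R).
Hypothesis dC : forall s t, d s t = d t s.
Hypothesis dT : forall r s t, (d r t <= d r s + d s t)%E.
Hypothesis dcont : forall t e, 0 < e -> \forall s \near t, (d s t <= e%:E)%E.
Hypothesis dper : forall e : R, 0 < e -> exists l : R, 0 < l /\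
  forall a : R, exists tau : R, a <= tau <= a + l /\
    forall t : R, (d (t + tau)%R t <= e%:E)%E.

Let d_le_trans r s t (a b : R) : (d r s <= a%:E)%E -> (d s t <= b%:E)%E ->
  (d r t <= (a + b)%:E)%E.
Proof. by move=> h1 h2; apply: (le_trans (dT r s t)); rewrite EFinD leeD. Qed.

(** Compactness gives uniform continuity on an interval that contains a
    translate, by an almost period, of every point of the line. *)
Lemma almost_periodic_uniform (e : R) : 0 < e ->
  \forall h \near (0 : R), forall t, (d (t + h)%R t <= e%:E)%E.
Proof.
move=> e0; have e30 : 0 < e / 3 by rewrite divr_gt0.
have [l [l0 Hl]] := dper e30.
have /compact_near_coveringP cpt : compact [set` `[0 : R, l]].
  exact: segment_compact.
have : \forall h \near (0 : R),
    [set` `[0 : R, l]] `<=` [set x : R | (d (x + h)%R x <= (e / 3)%:E)%E].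
  apply: (cpt R (nbhs (0 : R)) (fun h x => (d (x + h)%R x <= (e / 3)%:E)%E)
    (nbhs_filter _)) => x _.
  have e60 : 0 < e / 6 by rewrite divr_gt0.
  have /nbhs_ballP[r /= r0 Hr] := dcont x e60.
  have r20 : 0 < r / 2 by rewrite divr_gt0.
  exists (ball x (r / 2), ball 0 (r / 2)) => /=.
    by split; apply/nbhs_ballP; exists (r / 2).
  move=> [y h] [/= xy h0].
  rewrite (_ : e / 3 = e / 6 + e / 6); last by field.
  apply: (@d_le_trans _ x); last rewrite dC;
    apply: Hr; rewrite /ball /= in xy h0 *.
    have -> : x - (y + h) = (x - y) + (0 - h) by ring.
    by apply: le_lt_trans (ler_normD _ _) _; lra.
  lra.
apply: filterS => h Hh t.
have [tau [/andP[t1 t2] Htau]] := Hl (- t).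
rewrite (_ : e = e / 3 + (e / 3 + e / 3)); last by field.
apply: (@d_le_trans _ (t + h + tau)); first by rewrite dC.
apply: (@d_le_trans _ (t + tau)) => //.
rewrite addrAC; apply: Hh; rewrite /= in_itv /=; apply/andP; split; lra.
Qed.

(** Along an ultrafilter, the translates eventually stay close to each other:
    up to an almost period, they range over a compact interval. *)
Lemma almost_periodic_ultra (a : nat -> R) (U : set_system nat) (e : R) :
  UltraFilter U -> 0 < e -> exists A, U A /\ forall m n, A m -> A n ->
    forall t, (d (t + a m)%R (t + a n)%R <= e%:E)%E.
Proof.
move=> UU e0; have e40 : 0 < e / 4 by rewrite divr_gt0.
have [l [l0 Hl]] := dper e40.
have /choice[tau Htau] : forall n, exists tau : R, 0 <= a n - tau <= l /\
    forall t : R, (d (t + tau)%R t <= (e / 4)%:E)%E.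
  move=> n; have [tau [/andP[t1 t2] H]] := Hl (a n - l); exists tau; split=> //.
  by apply/andP; split; lra.
pose r n := a n - tau n.
have PU : ProperFilter U by exact: ultra_proper.
have cpt : compact [set` `[0 : R, l]] by exact: segment_compact.
have [|c [_ /= Hc]] := cpt (r @ U) _.
  by apply: (@filterE _ U) => n /=; rewrite in_itv /=; have [] := Htau n.
have Uball s : 0 < s -> U [set n | ball c s (r n)].
  move=> s0; have [//|H] := in_ultra_setVsetC [set n | ball c s (r n)] UU.
  have [y [/= yF yb]] : (~` ball c s) `&` ball c s !=set0.
    by apply: Hc; [exact: H|apply/nbhs_ballP; exists s].
  by [].
exists [set n | forall t, (d (t + r n)%R (t + c)%R <= (e / 4)%:E)%E]; split.
  have := almost_periodic_uniform e40 => /nbhs_ballP[s /= s0 Hs].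
  apply: filterS (Uball s s0) => n /= cn t.
  have -> : t + r n = (t + c) + (r n - c) by ring.
  apply: Hs; rewrite /ball /= in cn *.
  by rewrite sub0r normrN distrC.
move=> m n /= Hm Hn t.
rewrite (_ : e = (e / 4 + e / 4) + (e / 4 + e / 4)); last by field.
have near_r k s : (d (s + a k)%R (s + r k)%R <= (e / 4)%:E)%E.
  have -> : s + a k = (s + r k) + tau k by rewrite /r; ring.
  exact: (Htau k).2.
apply: (@d_le_trans _ (t + c)); last rewrite dC.
  by apply: d_le_trans (near_r _ _) (Hm t).
by apply: d_le_trans (near_r _ _) (Hn t).
Qed.

(** Near the ultrafilter all accuracies [eps j] are available simultaneously, so
    a subsequence can be picked without a diagonal argument. *)
Lemma almost_periodic_subsequence (a : nat -> R) (eps : nat -> R) :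
  (forall j, 0 < eps j) ->
  exists k : nat -> nat, {homo k : m n / (m < n)%N} /\
    forall j m n, (j <= m)%N -> (j <= n)%N ->
      forall t, (d (t + a (k m))%R (t + a (k n))%R <= (eps j)%:E)%E.
Proof.
move=> eps0; have [U [UU ooU]] := ultraFilterLemma eventually_filter.
have PU : ProperFilter U by exact: ultra_proper.
have /choice[A HA] := fun j => almost_periodic_ultra a UU (eps0 j).
have B j : U [set n | forall i, (i <= j)%N -> A i n].
  elim: j => [|j IH].
    by apply: filterS (HA 0).1 => n A0 i; rewrite leqn0 => /eqP ->.
  apply: filterS2 (HA j.+1).1 IH => n Aj IH i.
  by rewrite leq_eqVlt => /predU1P[->//|]; rewrite ltnS; exact: IH.
have /choice[nxt Hnxt] : forall jN : nat * nat, exists n, (jN.2 < n)%N /\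
    forall i, (i <= jN.1)%N -> A i n.
  move=> [j N]; have UN : U [set n | (N < n)%N] by apply: ooU; exists N.+1.
  have [n [n1 n2]] := filter_ex (filterI UN (B j)).
  by exists n.
pose fix k j := if j is j'.+1 then nxt (j, k j') else nxt (0, 0)%N.
have kA j i : (i <= j)%N -> A i (k j).
  by case: j => [|j] /=; apply: (Hnxt (_, _)).2.
exists k; split.
  by apply: homo_ltn ltn_trans _ => j; exact: (Hnxt (_, _)).1.
by move=> j m n jm jn; apply: (HA j).2; exact: kA.
Qed.

End Bochner.
(** * Translates of a function on the line *)

Lemma cvg_ereal0P (R : realType) (T : Type) (F : set_system T) {FF : Filter F}
    (f : T -> \bar R) : (forall x, 0 <= f x)%E ->
  f @ F --> 0%E <->
  (forall e : R, 0 < e -> \forall x \near F, (f x <= e%:E)%E).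
Proof.
move=> f0; split=> [/fine_cvgP[ff /cvgr0Pnorm_le H] e e0|H].
  apply: filterS2 ff (H e e0) => x fx; rewrite ger0_norm ?fine_ge0//.
  by rewrite -lee_fin fineK.
have ff e : 0 < e -> \forall x \near F, f x \is a fin_num /\ fine (f x) <= e.
  move=> /H; apply: filterS => x fx.
  have fin : f x \is a fin_num.
    by rewrite ge0_fin_numE//; apply: le_lt_trans fx _; rewrite ltry.
  by split=> //; rewrite -lee_fin fineK.
apply/fine_cvgP; split; first by apply: filterS (ff 1 ltr01) => x [].
apply/cvgr0Pnorm_le => e /ff; apply: filterS => x [_].
by rewrite ger0_norm ?fine_ge0.
Qed.

Section Translates.
Variables (R : realType) (X : completeNormedModType R[i]) (p : R -> \bar R).
Hypothesis hp : variable_exponent p.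
Implicit Types (I : set R) (f g : R -> X).

Local Notation U := (@unit_interval R).

Lemma strongly_measurable_hat g t :
  strongly_measurable setT g -> strongly_measurable U (hat g t).
Proof.
move=> sg; have := strongly_measurable_shift t sg.
rewrite (_ : (fun x => g (x + t)) = hat g t); last first.
  by apply/funext => x; rewrite /hat addrC.
by apply: strongly_measurableS => //; exact: unit_interval_measurable.
Qed.

Lemma LS_bound I f : LS p I f ->
  exists M : R, forall t, I t -> (Lp_norm p (hat f t) <= M%:E)%E.
Proof.
move=> [_ [_ H]]; set S := ereal_sup _ in H.
have le_S t : I t -> (Lp_norm p (hat f t) <= S)%E.
  by move=> It; apply: ereal_sup_ubound; exists t.
case: S H le_S => [M| |] // _ le_S; first by exists M.
exists 0 => t /le_S; rewrite leeNy_eq => /eqP tE.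
by have := Lp_norm_ge0 p (hat f t); rewrite tE.
Qed.

Lemma LS_of_bound I f (M : R) : strongly_measurable I f ->
  (forall t, I t -> strongly_measurable U (hat f t)) ->
  (forall t, I t -> (Lp_norm p (hat f t) <= M%:E)%E) -> LS p I f.
Proof.
move=> sf sfh H; split=> //; split=> [t It|].
  by apply: Lp_of_norm; [exact: sfh|apply: le_lt_trans (H t It) _; exact: ltry].
apply: (@le_lt_trans _ _ M%:E); last exact: ltry.
by apply: ge_ereal_sup => _ [t It <-]; exact: H.
Qed.

(** The pointwise limit is taken on the line itself, so that one function
    represents the limits on all translates. *)
Lemma ae_lim_translates (f_ : nat -> R -> X) :
  (forall n, strongly_measurable setT (f_ n)) ->
  (forall t, {ae leb R, forall x : lebesgueR R, U x ->
     cvgn (fun n => hat (f_ n) t x)}) ->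
  exists g, strongly_measurable setT g /\
    {ae leb R, forall x : lebesgueR R, f_ n x @[n --> \oo] --> g x}.
Proof.
move=> sf cf; exists (fun x => limn (fun n => f_ n x)).
have cg : {ae leb R, forall x : lebesgueR R,
    f_ n x @[n --> \oo] --> limn (fun n => f_ n x)}.
  by apply: ae_unit_translates => t; exact: cf.
split=> //; apply: strongly_measurable_ae_lim sf _; first exact: measurableT.
by apply: filterS cg.
Qed.

Lemma ae_hat (P : R -> Prop) t :
  {ae leb R, forall x : lebesgueR R, P x} ->
  {ae leb R, forall x : lebesgueR R, U x -> P (t + (x : R))}.
Proof.
move=> /(ae_shift t); apply: filterS => x; rewrite addrC => Px _; exact: Px.
Qed.

Lemma Lp_norm_subC (F : R -> R -> X) s t :
  (forall r, strongly_measurable U (F r)) ->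
  Lp_norm p (F s - F t) = Lp_norm p (F t - F s).
Proof.
move=> sF; apply/eqP; rewrite eq_le; apply/andP; split;
  (apply: Lp_norm_ae_le => //; [exact: strongly_measurableB|
     exact: strongly_measurableB|]);
  by apply: aeW => x _; rewrite /= rnormB.
Qed.

Lemma Lp_norm_sub_triangle (F : R -> R -> X) r s t :
  (forall r, strongly_measurable U (F r)) ->
  (Lp_norm p (F r - F t)%R <=
   Lp_norm p (F r - F s)%R + Lp_norm p (F s - F t)%R)%E.
Proof.
move=> sF; apply: Lp_norm_triangle => //; try exact: strongly_measurableB.
by apply: aeW => x _; exact: rnormD_sub.
Qed.

End Translates.
(** * Almost periodicity implies almost automorphy *)

Section AlmostPeriodic.
Variables (R : realType) (X : completeNormedModType R[i]) (p : R -> \bar R).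
Hypothesis hp : variable_exponent p.
Implicit Types (f g : R -> X).

Local Notation U := (@unit_interval R).
Local Notation norm u := (Lp_norm p u%R).

Lemma Lp_continuous_near (I : set R) (F : R -> R -> X) t (e : R) :
  Lp_continuous p I F -> I t -> 0 < e ->
  \forall s \near t, I s -> (norm (F s - F t) <= e%:E)%E.
Proof.
move=> [_ cF] It e0; have := cF t It.
by move/(cvg_ereal0P (fun s => Lp_norm_ge0 p (F s - F t))); apply.
Qed.

Lemma Lp_almost_periodic_subsequence (F : R -> R -> X) (a : nat -> R)
    (eps : nat -> R) : Lp_almost_periodic p F -> (forall j, 0 < eps j) ->
  exists k : nat -> nat, {homo k : m n / (m < n)%N} /\
    forall j m n, (j <= m)%N -> (j <= n)%N -> forall t,
      (norm (F (t + a (k m)) - F (t + a (k n))) <= (eps j)%:E)%E.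
Proof.
move=> [cF pF]; have sF t : strongly_measurable U (F t) by have [] := cF.1 t I.
apply: (almost_periodic_subsequence (d := fun s t => norm (F s - F t))).
- by move=> s t; exact: Lp_norm_subC.
- by move=> r s t; exact: Lp_norm_sub_triangle.
- move=> t e e0; apply: filterS (Lp_continuous_near cF I e0) => s; exact.
- exact: pF.
Qed.

Lemma S_almost_periodic_automorphic g :
  LS p setT g -> Lp_almost_periodic p (hat g) -> S_almost_automorphic p g.
Proof.
move=> gLS gap; split=> // a; have [sg _] := gLS.
have sgh t : strongly_measurable U (hat g t) by exact: strongly_measurable_hat.
(* The factor 1/2 makes the bound by [4 ^- n] strict. *)
pose eps n : R := 2^-1 ^+ n * 2^-1 ^+ n / 2.
have eps0 n : 0 < eps n.
  by rewrite /eps !mulr_gt0 ?exprn_gt0 ?invr_gt0.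
have [k [kmono Hk]] := Lp_almost_periodic_subsequence a gap eps0.
pose u n y := g (y + a (k n)).
have su n : strongly_measurable setT (u n).
  have := strongly_measurable_shift (a (k n)) sg.
  by rewrite (_ : [set x | _] = setT).
have uE n t : hat (u n) t = hat g (t + a (k n)).
  by apply/funext => x; rewrite /u /hat addrAC.
have [|h [sh uh]] := ae_lim_translates su.
  move=> t.
  pose v n := hat g (t + a (k n)) - hat g (t + a (k n.+1)).
  have sv n : strongly_measurable U (v n) by exact: strongly_measurableB.
  have : {ae leb R, forall x : lebesgueR R, U x ->
      \forall n \near \oo, rnorm (v n x) <= 2^-1 ^+ n}.
    apply: (ae_geometric_decay hp) => //; apply: nearW => n.
    apply: le_lt_trans (Hk n n n.+1 (leqnn _) (leqnSn _) t) _.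
    by rewrite lte_fin /eps ltr_pdivrMr// ltr_pMr ?ltr1n// mulr_gt0
      ?exprn_gt0 ?invr_gt0.
  apply: filterS => x vx Ux; apply: cvg_geometric_increments.
  apply: filterS (vx Ux) => n; rewrite /v /=.
  by rewrite -!uE.
have shh t : strongly_measurable U (hat h t) by exact: strongly_measurable_hat.
(* Uniformity in [t] matters: the second limit uses it at [t - a (k n)]. *)
have uhE j n t : (j <= n)%N ->
    (norm (hat g (t + a (k n)) - hat h t) <= (eps j)%:E)%E.
  move=> jn; apply: (Lp_norm_fatou hp
    (u_ := fun m => hat g (t + a (k n)) - hat g (t + a (k m)))).
  - by move=> m; exact: strongly_measurableB.
  - exact: strongly_measurableB.
  - apply: filterS (ae_hat t uh) => x H Ux.
    apply: cvgB; first exact: cvg_cst.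
    have := H Ux; rewrite (_ : (fun m => u m (t + x)) =
      (fun m => hat g (t + a (k m)) x))//.
    by apply/funext => m; rewrite -uE.
  - by exists j => // m jm; exact: Hk.
have [M HM] := LS_bound gLS.
exists k, h; split; first exact: kmono.
split.
  apply: (LS_of_bound (M := M + eps 0%N) sh (fun t _ => shh t)) => t _.
  rewrite EFinD; apply: le_trans (_ : norm (hat g (t + a (k 0%N))) +
    norm (hat g (t + a (k 0%N)) - hat h t) <= _)%E; last first.
    by apply: leeD; [exact: HM|exact: uhE].
  apply: (Lp_norm_triangle hp) => //; first exact: strongly_measurableB.
  apply: aeW => x _ /=; set b := hat g _ x; set c := hat h t x.
  by have := rnormD b (c - b); rewrite subrKC (rnormB c).
have lim (w : nat -> R -> X) :
   (forall j n, (j <= n)%N -> (norm (w n) <= (eps j)%:E)%E) ->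
   norm (w n) @[n --> \oo] --> 0%E.
  move=> Hw; apply/cvg_ereal0P; first by move=> n; exact: Lp_norm_ge0.
  move=> e e0; have [N _ HN] := near_half_pow_lt e0.
  exists N => // n /= Nn; apply: le_trans (Hw N n Nn) _.
  rewrite lee_fin; apply: le_trans (ltW (HN N (leqnn _))).
  rewrite /eps -mulrA ler_piMr ?exprn_ge0 ?invr_ge0//.
  have : (2^-1 : R) ^+ N <= 1 by apply: exprn_ile1; rewrite ?invr_ge0//; lra.
  by lra.
move=> t; split; apply: lim => j n jn.
  rewrite (_ : (fun x => _) = hat g (t + a (k n)) - hat h t); first exact: uhE.
  by apply/funext => x; rewrite /hat /=; congr (g _ - h _); ring.
apply: le_trans (uhE j n (t - a (k n)) jn).
have -> : (fun x => h (x - a (k n) + t) - g (x + t)) =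
    hat h (t - a (k n)) - hat g (t - a (k n) + a (k n)).
  by apply/funext => x; rewrite /hat /=; congr (h _ - g _); ring.
apply: (Lp_norm_ae_le hp); try exact: strongly_measurableB.
by apply: aeW => x _; rewrite /= rnormB.
Qed.

End AlmostPeriodic.
(** * The almost periodic part comes from a function on the line *)

Section Asymptotic.
Variables (R : realType) (X : completeNormedModType R[i]) (p : R -> \bar R).
Hypothesis hp : variable_exponent p.
Variables (f : R -> X) (G Q : R -> R -> X).
Hypothesis fLS : LS p (@half_line R) f.
Hypothesis Gap : Lp_almost_periodic p G.
Hypothesis QC0 : Lp_C0 p Q.
Hypothesis fGQ : forall t, half_line t -> ae_eq01 (hat f t) (G t + Q t).

Local Notation U := (@unit_interval R).
Local Notation norm u := (Lp_norm p u%R).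

Let half_lineP (t : R) : half_line t <-> 0 <= t.
Proof. by rewrite /half_line /= in_itv /= andbT. Qed.

Let sG t : strongly_measurable U (G t).
Proof. by have [] := Gap.1.1 t I. Qed.

Let sQ t : 0 <= t -> strongly_measurable U (Q t).
Proof. by move=> /half_lineP t0; have [] := QC0.1.1 t t0. Qed.

Let sfh t : 0 <= t -> strongly_measurable U (hat f t).
Proof. by move=> /half_lineP t0; have [] := fLS.2.1 t t0. Qed.

Let subE (u v : R -> X) (x : lebesgueR R) : (u - v) x = u x - v x.
Proof. by []. Qed.

Let addE (u v : R -> X) (x : lebesgueR R) : (u + v) x = u x + v x.
Proof. by []. Qed.

Lemma C0_part_small (e : R) : 0 < e ->
  exists T : R, 0 <= T /\ forall t, T <= t -> (norm (Q t) <= e%:E)%E.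
Proof.
move=> e0; have [_ cQ] := QC0.
move/(cvg_ereal0P (fun t => Lp_norm_ge0 p (Q t))): cQ => /(_ e e0)[T [Tr HT]].
exists (Num.max 0 (T + 1)); split; first by rewrite le_max lexx.
by move=> t; rewrite ge_max => /andP[_ Tt]; apply: HT; lra.
Qed.

(** Shifting [f] by almost periods of [G] that tend to infinity makes [Q]
    disappear and leaves [G] in the limit. *)
Lemma exists_base_function :
  exists g, strongly_measurable setT g /\ forall t, ae_eq01 (hat g t) (G t).
Proof.
(* Two errors, from [G] and from [Q], have to add up to less than [4 ^- n]. *)
pose eps n : R := 2^-1 ^+ n * 2^-1 ^+ n / 4.
have eps0 n : 0 < eps n by rewrite /eps !mulr_gt0 ?exprn_gt0 ?invr_gt0.
have /choice[tau Htau] : forall n, exists tau : R,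
   (forall t, n%:R + t >= 0 ->
      0 <= t + tau /\ (norm (Q (t + tau)) <= (eps n)%:E)%E) /\
   (forall t, (norm (G (t + tau) - G t) <= (eps n)%:E)%E).
  move=> n; have [T [T0 HT]] := C0_part_small (eps0 n).
  have [l [l0 Hl]] := Gap.2 _ (eps0 n).
  have [tau [/andP[h1 h2] Htau]] := Hl (T + n%:R).
  exists tau; split=> // t t0; split; first lra.
  by apply: HT; lra.
pose D n := [set y : R | half_line (y + tau n)].
pose f_ n y := if y \in D n then f (y + tau n) else 0.
have sf n : strongly_measurable setT (f_ n).
  apply: strongly_measurable_extend0; last first.
    exact: strongly_measurable_shift fLS.1.
  apply: (measurable_shift (A := @half_line R)).
  by apply: measurable_borel_leb; exact: measurable_itv.
have sfh_ n t : strongly_measurable U (hat (f_ n) t).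
  exact: strongly_measurable_hat.
have cvgG t : {ae leb R, forall x : lebesgueR R, U x ->
    hat (f_ n) t x @[n --> \oo] --> G t x}.
  have : {ae leb R, forall x : lebesgueR R, U x ->
      \forall n \near \oo, rnorm ((hat (f_ n) t - G t) x) <= 2^-1 ^+ n}.
    apply: (ae_geometric_decay hp) => [n|]; first exact: strongly_measurableB.
    exists (Num.truncn `|t|).+1 => // n /= tn.
    have nt : 0 <= n%:R + t.
      have : `|t| <= n%:R.
        by apply: le_trans (ltW (truncnS_gt _)) _; rewrite ler_nat.
      by rewrite ler_norml => /andP[? ?]; lra.
    have [HQ HG] := Htau n; have [tt0 {}HQ] := HQ t nt.
    apply: (@le_lt_trans _ _ (eps n + eps n)%:E); last first.
      have h0 : 0 < (2^-1 : R) ^+ n * 2^-1 ^+ n.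
        by rewrite mulr_gt0 ?exprn_gt0 ?invr_gt0.
      by rewrite lte_fin /eps; lra.
    rewrite EFinD; apply: le_trans (leeD (HG t) HQ).
    apply: (Lp_norm_triangle hp).
    - exact: strongly_measurableB.
    - exact: strongly_measurableB.
    - exact: sQ.
    have /half_lineP th := tt0.
    apply: filterS (fGQ th) => x fx Ux /=.
    have fE : hat (f_ n) t x = G (t + tau n) x + Q (t + tau n) x.
      rewrite /hat /f_ ifT; first by rewrite addrAC; exact: fx.
      rewrite inE /D /=; apply/half_lineP.
      by move: Ux; rewrite /unit_interval /= in_itv /= => /andP[? ?]; lra.
    rewrite !subE fE addrAC.
    exact: rnormD.
  apply: filterS => x Hx Ux; apply/cvg_rnormP => e e0.
  by apply: filterS2 (Hx Ux) (near_half_pow_lt e0) => n h1 h2;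
    apply: le_trans h1 (ltW h2).
have [|g [sg cg]] := ae_lim_translates sf.
  move=> t; apply: filterS (cvgG t) => x H Ux.
  by apply/cvg_ex; exists (G t x); exact: H.
exists g; split=> // t.
apply: filterS2 (cvgG t) (ae_hat t cg) => x H1 H2 Ux.
apply: (@cvg_unique _ (@norm_hausdorff _ X) _ _ _ _ (H2 Ux) (H1 Ux)).
Qed.

(** Every translate is close to one so far out that [G] is close to the
    translates of [f], which are bounded. *)
Lemma periodic_part_bounded : exists M : R, forall t, (norm (G t) <= M%:E)%E.
Proof.
have [Mf HMf] := LS_bound fLS.
have [T [T0 HT]] := C0_part_small ltr01.
have [l [l0 Hl]] := Gap.2 _ ltr01.
exists (1 + (Mf + 1)) => t.
have [tau [/andP[h1 h2] Htau]] := Hl (T - t).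
have Tt : T <= t + tau by lra.
have t0 : 0 <= t + tau by lra.
have /half_lineP th := t0.
rewrite 2!EFinD; apply: le_trans (leeD (Htau t) (leeD (HMf _ th) (HT _ Tt))).
apply: (@le_trans _ _ (norm (G (t + tau) - G t) + norm (G (t + tau)))%E).
  apply: (Lp_norm_triangle hp) => //; first exact: strongly_measurableB.
  apply: aeW => x _ /=; set b := G (t + tau) x; set c := G t x.
  by have := rnormD b (c - b); rewrite subrKC (rnormB c) addrC.
apply: leeD => //; apply: (Lp_norm_triangle hp).
- exact: sG.
- exact: sfh.
- exact: sQ.
apply: filterS (fGQ th) => x fx Ux; have {}fx := fx Ux.
have := rnormD (hat f (t + tau) x) (- Q (t + tau) x).
by rewrite rnormN fx /= addrK.
Qed.

Lemma asymp_S_automorphic_of_decomposition : asymp_S_almost_automorphic p f.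
Proof.
split; first exact: fLS.
have [g [sg gG]] := exists_base_function.
have sgh t : strongly_measurable U (hat g t) by exact: strongly_measurable_hat.
have [M HM] := periodic_part_bounded.
have gM t : (norm (hat g t) <= M%:E)%E.
  by rewrite (Lp_norm_ae_eq hp (sgh t) (sG t) (gG t)).
have gLS : LS p setT g by exact: (LS_of_bound (M := M) sg).
have gap : Lp_almost_periodic p (hat g).
  have gE s t : norm (hat g s - hat g t) = norm (G s - G t).
    apply: (Lp_norm_ae_eq hp); try exact: strongly_measurableB.
    apply: filterS2 (gG s) (gG t) => x Hs Ht Ux.
    exact: (congr2 (fun a b => a - b) (Hs Ux) (Ht Ux)).
  split; last first.
    move=> e e0; have [l [l0 Hl]] := Gap.2 e e0.
    exists l; split; first exact: l0.
    move=> a; have [tau [atau Htau]] := Hl a.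
    by exists tau; split; [exact: atau|move=> t; rewrite gE].
  split; first exact: gLS.2.1.
  move=> t It; rewrite (_ : (fun s => _) = (fun s => norm (G s - G t))).
    exact: Gap.1.2.
  by apply/funext => s; exact: gE.
pose q := f - g.
have qE t : hat q t = hat f t - hat g t by [].
have sqh t : 0 <= t -> strongly_measurable U (hat q t).
  by move=> t0; rewrite qE; apply: strongly_measurableB; [exact: sfh|].
have qQ t : 0 <= t -> ae_eq01 (hat q t) (Q t).
  move=> t0; have /half_lineP th := t0.
  apply: filterS2 (fGQ th) (gG t) => x H1 H2 Ux.
  by rewrite qE subE H1// H2// addE addrC addKr.
have mhalf : measurable (@half_line R : set (lebesgueR R)).
  by apply: measurable_borel_leb; exact: measurable_itv.
have qLS : LS p (@half_line R) q.
  have [Mf HMf] := LS_bound fLS.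
  apply: (LS_of_bound (M := Mf + M)).
  - apply: strongly_measurableB; first exact: fLS.1.
    by apply: strongly_measurableS sg.
  - by move=> t /half_lineP; exact: sqh.
  move=> t th; have /half_lineP t0 := th.
  rewrite EFinD; apply: le_trans (leeD (HMf t th) (gM t)).
  apply: (Lp_norm_triangle hp); [exact: sqh|exact: sfh|exact: sgh|].
  by apply: aeW => x _; rewrite qE -(rnormN (hat g t x)); exact: rnormD.
exists g, q; split; first exact: S_almost_periodic_automorphic.
split; first exact: qLS.
split; first by move=> t _; rewrite /q /= subrKC.
split; last first.
  apply/cvg_ereal0P; first by move=> t; exact: Lp_norm_ge0.
  move=> e e0; have [T [T0 HT]] := C0_part_small e0.
  exists T; split; first exact: num_real.
  move=> t Tt; have t0 : 0 <= t by lra.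
  by rewrite (Lp_norm_ae_eq hp (sqh t t0) (sQ t0) (qQ t t0)) HT// ltW.
split; first exact: qLS.2.1.
move=> t th; have /half_lineP t0 := th.
apply/cvg_ereal0P; first by move=> s; exact: Lp_norm_ge0.
move=> e e0; have := Lp_continuous_near QC0.1 th e0.
rewrite near_withinE; apply: filterS => s Hs sh; have /half_lineP s0 := sh.
rewrite (_ : norm _ = norm (Q s - Q t)); first exact: Hs.
apply: (Lp_norm_ae_eq hp).
- by apply: strongly_measurableB; exact: sqh.
- by apply: strongly_measurableB; exact: sQ.
apply: filterS2 (qQ s s0) (qQ t t0) => x H1 H2 Ux.
exact: (congr2 (fun a b => a - b) (H1 Ux) (H2 Ux)).
Qed.

End Asymptotic.

Theorem proposition3p6 (R : realType) (X : completeNormedModType R[i])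
    (p : R -> \bar R) (hp : variable_exponent p)
    (f : R -> X) (hf : asymp_S_almost_periodic p f) :
  asymp_S_almost_automorphic p f.
Proof.
have [fLS [_ [G [Q [Gap [QC0 fGQ]]]]]] := hf.
exact: (asymp_S_automorphic_of_decomposition hp fLS Gap QC0 fGQ).
Qed.
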